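(* Let $G$ be the directed graph on vertex set $\{v_0,\dots,v_8,w_2,w_3,w_4\}$, where a vertex with index $i$ belongs to gender class $i \bmod 3$, and all indices of $v$ are taken modulo $9$. Its edges and ranks are: (1) $(v_i,v_{i+1})$ for $i=0,\dots,8$, of rank $1$; (2) $(w_i,v_{i-2})$ for $i=2,3,4$, of rank $1$; (3) $(v_i,w_{i+1})$ for $i=1,2,3$, of rank $2$; (4) $(v_i,v_{i+4})$ for $i=0,\dots,8$, of rank $2$ when $i\in\{0,4,5,6,7,8\}$ and of rank $3$ when $i\in\{1,2,3\}$. Then this instance of 3DSMI of dimension $4$ has no stable matching.
   Context: An instance of 3DSMI of dimension $n$ is a directed graph $G$ without multiple edges whose vertex set is partitioned into three gender classes of size $n$ each, cyclically ordered (men $\to$ women $\to$ dogs $\to$ men), with every edge going from a class to the next class in this cyclic order (here from class $i$ to class $i+1 \bmod 3$). Each edge $(v,v')$ carries a positive integer rank $r(v,v')$, and for every vertex $v$ of out-degree $k$ the ranks of edges leaving $v$ are exactly $1,\dots,k$. A family is a directed $3$-cycle of $G$. A matching $\mathcal M$ is a set of pairwise vertex-disjoint families. For a vertex $v$, $R_{\mathcal M}(v)$ is the rank of the edge leaving $v$ within its family in $\mathcal M$, and $R_{\mathcal M}(v)=+\infty$ if $v$ lies in no family of $\mathcal M$. A directed $3$-cycle $(v,v',v'')$ of $G$ is blocking for $\mathcal M$ if $r(v,v')<R_{\mathcal M}(v)$, $r(v',v'')<R_{\mathcal M}(v')$ and $r(v'',v)<R_{\mathcal M}(v'')$. A matching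 is stable if it has no blocking triple. *)

(* Defs.v *)
From mathcomp Require Import all_boot.

Set Implicit Arguments.
Unset Strict Implicit.
Unset Printing Implicit Defensive.

(* Raw data of a 3DSMI instance. Genders are 0 = men, 1 = women, 2 = dogs. Since
   [edge] is a relation there are no multiple edges; [rank x y] is meaningful
   only when [edge x y]. *)
Record ranked_digraph := RankedDigraph {
  vertex :> finType;
  gender : vertex -> 'I_3;
  edge : rel vertex;
  rank : vertex -> vertex -> nat }.

Arguments gender {r}.
Arguments edge {r}.
Arguments rank {r}.

(* [ordS] is the cyclic successor of 'I_3. The last condition says that the
   ranks of the k edges leaving x are exactly 1, ..., k, each used once. *)
Definition is_3DSMI (n : nat) (G : ranked_digraph) : Prop :=
  [/\ forall g : 'I_3, #|[set x : G | gender x == g]| = n,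
      forall x y : G, edge x y -> gender y = ordS (gender x)
    & forall x : G, perm_eq [seq rank x y | y in edge x] (iota 1 #|edge x|)].

Section Matching.
Variable G : ranked_digraph.

(* A directed 3-cycle (x, y, z) is represented by any of its three rotations;
   all notions below are invariant under rotation, and [is_matching] forbids
   two rotations of the same cycle because they share vertices. *)
Definition is_family (t : 3.-tuple G) : bool := ucycleb edge t.

Definition is_matching (M : {set 3.-tuple G}) : Prop :=
  (forall t, t \in M -> is_family t) /\
  (forall t t', t \in M -> t' \in M -> t != t' -> [disjoint t & t']).

(* The rank R_M(v), with None standing for +oo. *)
Definition matched_rank (M : {set 3.-tuple G}) (v : G) : option nat :=
  omap (fun t : 3.-tuple G => rank v (next t v)) [pick t in M | v \in t].

Definition lt_rank (k : nat) (R : option nat) : bool :=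
  if R is Some m then k < m else true.

Definition is_blocking (M : {set 3.-tuple G}) (t : 3.-tuple G) : Prop :=
  is_family t /\
  (forall v, v \in t -> lt_rank (rank v (next t v)) (matched_rank M v)).

Definition is_stable_matching (M : {set 3.-tuple G}) : Prop :=
  is_matching M /\ ~ exists t, is_blocking M t.

End Matching.

(* [inl i] is v_i and [inr j] is w_(j + 2). *)
Notation vertex4 := ('I_9 + 'I_3)%type.

Definition v_ (i : nat) : vertex4 := inl (Ordinal (ltn_pmod i (isT : 0 < 9))).

(* Only used for i = 2, 3, 4. *)
Definition w_ (i : nat) : vertex4 :=
  inr (Ordinal (ltn_pmod (i - 2) (isT : 0 < 3))).

Definition index4 (x : vertex4) : nat :=
  match x with inl i => i | inr j => j + 2 end.

Definition gender4 (x : vertex4) : 'I_3 :=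
  Ordinal (ltn_pmod (index4 x) (isT : 0 < 3)).

Definition ranked_edges4 : seq (vertex4 * vertex4 * nat) :=
  [seq (v_ i, v_ (i + 1), 1) | i <- iota 0 9] ++
  [seq (w_ i, v_ (i - 2), 1) | i <- [:: 2; 3; 4]] ++
  [seq (v_ i, w_ (i + 1), 2) | i <- [:: 1; 2; 3]] ++
  [seq (v_ i, v_ (i + 4), if i \in [:: 1; 2; 3] then 3 else 2) | i <- iota 0 9].

(* The edges are listed without repetition, so that each has a single rank. *)
Lemma uniq_ranked_edges4 : uniq (unzip1 ranked_edges4).
Proof. by []. Qed.

Definition edge4 : rel vertex4 :=
  fun x y => (x, y) \in unzip1 ranked_edges4.

Definition rank4 (x y : vertex4) : nat :=
  nth 0 (unzip2 ranked_edges4) (index (x, y) (unzip1 ranked_edges4)).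

Definition G4 : ranked_digraph := RankedDigraph gender4 edge4 rank4.

(* Main.v *)
(** The graph has, up to rotation, twelve families: the triples
    (v_i, v_{i+1}, v_{i+5}), since 1 + 4 + 4 = 9 is the only way to close up
    with steps 1 and 4 modulo 9, and the triples (v_{i-2}, v_{i-1}, w_i).
    A stable matching amounts to a set of pairwise disjoint families among
    these twelve such that every family t has a vertex which the set matches
    at least as well as t does. There are only finitely many disjoint sets of
    families, and none of them has this property. *)
Require Import Defs.
From mathcomp Require Import all_boot.

Set Implicit Arguments.
Unset Strict Implicit.
Unset Printing Implicit Defensive.

Fixpoint sublists (T : Type) (s : seq T) : seq (seq T) :=
  if s is x :: s' then
    let r := sublists s' in r ++ [seq x :: u | u <- r]
  else [:: [::]].

Lemma filter_sublists (T : eqType) (a : pred T) (s : seq T) :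
  filter a s \in sublists s.
Proof.
elim: s => [|x s IHs] //=; rewrite mem_cat.
by case: (a x); rewrite ?IHs // map_f ?orbT.
Qed.

Section Representatives.
Variable G : ranked_digraph.
Implicit Types (t u : 3.-tuple G) (F : seq (3.-tuple G)).

Definition rotated t u : bool := has (fun n => rot n u == t :> seq G) (iota 0 3).

(** [all2rel] also compares an entry with itself, and [F] may hold two rotations of one cycle; hence
    [perm_eq] is allowed besides disjointness. *)
Definition independent F : bool :=
  all2rel (fun t u => has (mem t) u ==> perm_eq t u) F.

Definition dominates F t : bool :=
  has (fun u => has (fun x => (x \in u) &&
                  (rank x (next u x) <= rank x (next t x))) t) F.

(** Membership and [next] are invariant under rotation, so [M] can be traded for the rotations of
    its members listed in [F]. Stability then becomes a boolean test on sublists of a fixed list. *)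
Lemma stable_matching_representatives F (M : {set 3.-tuple G}) :
    (forall t, t \in F -> is_family t) ->
    (forall u, is_family u -> has (fun t => rotated t u) F) ->
    is_stable_matching M ->
  exists2 F', F' \in sublists F & independent F' && all (dominates F') F.
Proof.
move=> famF reprF [[famM disjM] stableM].
exists [seq t <- F | [exists u in M, rotated t u]]; first exact: filter_sublists.
apply/andP; split.
  apply/allrelP => t t'; rewrite !mem_filter.
  move=> /andP[/existsP[u /andP[Mu /hasP[n _ /eqP Dt]]] _].
  move=> /andP[/existsP[u' /andP[Mu' /hasP[n' _ /eqP Dt']]] _].
  apply/implyP => /hasP[x xt' xt].
  have xu : x \in u by rewrite -(mem_rot n) Dt.
  have xu' : x \in u' by rewrite -(mem_rot n') Dt'.
  have [Duu'|neq_uu'] := eqVneq u u'.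
    by rewrite -Dt -Dt' Duu' perm_rot perm_sym perm_rot.
  by rewrite (disjointFr (disjM _ _ Mu Mu' neq_uu') xu) in xu'.
(* An undominated [t] would block [M]: an unmatched vertex has rank +oo, and if a matched vertex did
   not prefer [t], the representative in [F] of its family would dominate [t]. *)
apply/allP => t Ft; apply/negP => undom_t; apply: stableM.
exists t; split=> [|x xt]; first exact: famF.
rewrite /matched_rank; case: pickP => //= u /andP[Mu xu].
rewrite ltnNge; apply/negP => le_rank; apply: undom_t.
have famu := famM u Mu; have /hasP[u' Fu' rot_u'] := reprF u famu.
apply/hasP; exists u'.
  by rewrite mem_filter Fu' andbT; apply/existsP; exists u; rewrite Mu.
apply/hasP; exists x => //.
have /hasP[n _ /eqP Du'] := rot_u'.
have /andP[_ uniq_u] := famu.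
have xu' : x \in u' by rewrite -(mem_rot n) Du' in xu.
by rewrite xu' -Du' next_rot.
Qed.

End Representatives.

(** An explicit list turns quantifiers over vertices into [all] tests that [vm_compute]
    evaluates. *)
Definition vertices4 : seq G4 :=
  [seq v_ i | i <- iota 0 9] ++ [seq w_ i | i <- [:: 2; 3; 4]].

Definition families4 : seq (3.-tuple G4) :=
  [seq [tuple v_ i; v_ (i + 1); v_ (i + 5)] | i <- iota 0 9] ++
  [seq [tuple v_ (i - 2); v_ (i - 1); w_ i] | i <- [:: 2; 3; 4]].

Lemma mem_vertices4 (x : G4) : x \in vertices4.
Proof.
case: x => i; rewrite mem_cat.
  have -> : inl i = v_ i by congr inl; apply: val_inj; rewrite /= modn_small.
  by rewrite map_f // mem_iota ltn_ord.
have -> : inr i = w_ (i + 2).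
  by congr inr; apply: val_inj; rewrite /= addnK modn_small.
by rewrite orbC map_f //; case: i => [[|[|[]]]].
Qed.

Lemma enum_vertices4 (A : pred G4) : perm_eq (enum A) (filter A vertices4).
Proof.
apply: uniq_perm => [||x]; first exact: enum_uniq.
  by rewrite filter_uniq //; vm_compute.
by rewrite mem_enum mem_filter mem_vertices4 andbT.
Qed.

Lemma forall_vertices4 (P : pred G4) : all P vertices4 -> forall x, P x.
Proof. by move=> /allP allP x; apply/allP/mem_vertices4. Qed.

Lemma G4_is_3DSMI : is_3DSMI 4 G4.
Proof.
split=> [g|x y|x].
- rewrite cardsE cardE (perm_size (enum_vertices4 _)).
  by case: g => [[|[|[]]]] // lt_g3; vm_compute.
- move=> xy; apply/eqP; move: xy; apply/implyP.
  by move: y; apply: forall_vertices4;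
    move: x; apply: forall_vertices4; vm_compute.
- rewrite cardE (perm_size (enum_vertices4 _)).
  apply: perm_trans (perm_map _ (enum_vertices4 _)) _.
  by move: x; apply: forall_vertices4; vm_compute.
Qed.

(** Exhaustive check of the 12^3 triples of vertices. *)
Lemma families4_complete (t : 3.-tuple G4) :
  is_family t -> has (fun u => rotated u t) families4.
Proof.
case/tupleP: t => x t; case/tupleP: t => y t; case/tupleP: t => z t.
rewrite (tuple0 t) -[cons_tuple _ _]/[tuple x; y; z]; apply/implyP.
move: z; apply: forall_vertices4; move: y; apply: forall_vertices4.
by move: x; apply: forall_vertices4; vm_compute.
Qed.

(** Exhaustive search: of the 2^12 sublists, only the independent ones are tested for domination. *)
Lemma families4_unstable :
  all (fun F => ~~ all (dominates F) families4)
      (filter (@independent G4) (sublists families4)).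
Proof. by vm_compute. Qed.

Theorem theorem4 :
  is_3DSMI 4 G4 /\
  ~ (exists M : {set 3.-tuple G4}, is_stable_matching M).
Proof.
split; first exact: G4_is_3DSMI.
case=> M stableM.
have [||F subF /andP[indepF domF]] :=
  @stable_matching_representatives G4 families4 M _ _ stableM.
- by apply/allP; vm_compute.
- exact: families4_complete.
- have /allP/(_ F) := families4_unstable.
  by rewrite mem_filter indepF subF domF => /(_ isT).
Qed.
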